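(* For every Peano continuum $X$, $$\dim(X)\le \mathsf{S}\text{-}\mathrm{dim}(X)\le\text{Hö-dim}(X)\le 2\cdot\mathsf{S}\text{-}\mathrm{dim}(X).$$
   Context: A Hausdorff topological space $X$ is a Peano continuum if there is a surjective continuous map $[0,1]\to X$. Let $\mathcal M_X$ be the set of all metrics on $X$ generating the topology of $X$. For $d\in\mathcal M_X$ and $\varepsilon>0$, let $N_{(X,d)}(\varepsilon)$ be the smallest cardinality of a cover of $X$ by subsets of $d$-diameter $\le\varepsilon$, and $S_{(X,d)}(\varepsilon)$ the smallest cardinality of a cover of $X$ by connected subsets of $d$-diameter $\le\varepsilon$ (finite by a theorem of Sierpiński). Put $\mathrm{Dim}(X,d)=\limsup_{\varepsilon\to0}\frac{\ln N_{(X,d)}(\varepsilon)}{\ln(1/\varepsilon)}$, $\mathsf{S}\text{-}\mathsf{Dim}(X,d)=\limsup_{\varepsilon\to0}\frac{\ln S_{(X,d)}(\varepsilon)}{\ln(1/\varepsilon)}$, and $\text{Hö-Dim}(X,d)=\inf\{\alpha\in(0,\infty]:\text{there is a surjective }\tfrac1\alpha\text{-Hölder function }f:[0,1]\to (X,d)\}$, where $\frac1\infty=0$; for $\beta\ge0$ a function $f$ between metric spaces is $\beta$-Hölder if $d_Y(f(x),f(x'))\le C\,d_X(x,x')^\beta$ for some constant $C>0$ and all $x,x'$, and every function to a bounded metric space is regarded as $0$-Hölder. Then $\dim(X)=\inf\{\mathrm{Dim}(X,d):d\in\mathcal M_X\}$ (which coincides with the topological dimension of $X$ by the Pontrjagin–Schnirelmann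 theorem), $\mathsf{S}\text{-}\mathrm{dim}(X)=\inf\{\mathsf{S}\text{-}\mathsf{Dim}(X,d):d\in\mathcal M_X\}$ and $\text{Hö-dim}(X)=\inf\{\text{Hö-Dim}(X,d):d\in\mathcal M_X\}$. *)

(* Defs.v *)
From mathcomp Require Import all_boot all_order all_algebra.
From mathcomp Require Import all_classical all_reals all_analysis.

Set Implicit Arguments.
Unset Strict Implicit.
Unset Printing Implicit Defensive.

Import Order.TTheory GRing.Theory Num.Theory.
Import numFieldNormedType.Exports.

Local Open Scope classical_set_scope.
Local Open Scope ring_scope.

(* The map from [0, 1] is a total function on R, of which only the restriction
   to [0, 1] is constrained; its existence already makes X nonempty. *)
Definition peano_continuum (R : realType) (X : topologicalType) : Prop :=
  hausdorff_space X /\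
  exists f : R -> X, {within `[0, 1], continuous f} /\
    set_surj `[0, 1] [set: X] f.

Record is_metric (R : realType) (X : Type) (d : X -> X -> R) : Prop := {
  metric_ge0 : forall x y, 0 <= d x y;
  metric_eq0 : forall x y, d x y = 0 <-> x = y;
  metric_symm : forall x y, d x y = d y x;
  metric_tri : forall x y z, d x z <= d x y + d y z }.

Definition generates_topology (R : realType) (X : topologicalType)
    (d : X -> X -> R) : Prop :=
  forall (x : X) (A : set X),
    nbhs x A <-> exists2 e : R, 0 < e & [set y | d x y < e] `<=` A.

Definition compatible_metrics (R : realType) (X : topologicalType) :
    set (X -> X -> R) :=
  [set d | is_metric d /\ generates_topology d].

Section dimensions_of_a_metric.
Context (R : realType) (X : topologicalType) (d : X -> X -> R).

(* The diameter of the empty set is -oo here rather than 0; for a positive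
   epsilon this does not affect the condition diam A <= epsilon. *)
Definition diam (A : set X) : \bar R :=
  ereal_sup [set (d x y)%:E | x in A & y in A].

(* The least cardinality of a cover of X by sets of diameter at most eps that
   satisfy P, with value +oo when no finite such cover exists. *)
Definition min_cover (P : set (set X)) (eps : R) : \bar R :=
  ereal_inf [set n%:R%:E | n in [set n : nat | exists C : set (set X),
    [/\ (C #= `I_n)%card, \bigcup_(A in C) A = [set: X] &
        forall A, C A -> P A /\ (diam A <= eps%:E)%E]]].

Definition covering_number : R -> \bar R := min_cover setT.

Definition connected_covering_number : R -> \bar R := min_cover connected.

Definition growth_exponent (M : R -> \bar R) : \bar R :=
  limf_esup (fun eps : R => lne (M eps) / (ln eps^-1)%:E)%E 0^'+.

Definition Dim : \bar R := growth_exponent covering_number.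

Definition SDim : \bar R := growth_exponent connected_covering_number.

(* For beta = 0 the bound is d (f s) (f t) <= C also when s = t, as powR gives
   0 `^ 0 = 1; hence 0-Hoelder means having bounded image, and every function
   to a bounded metric space is 0-Hoelder. *)
Definition hoelder_unit_itv (beta : R) (f : R -> X) : Prop :=
  exists2 C : R, 0 < C &
    {in `[0, 1] &, forall s t, d (f s) (f t) <= C * `|s - t| `^ beta}.

(* In \bar R, the inverse of +oo is 0. *)
Definition HoDim : \bar R :=
  ereal_inf [set alpha : \bar R | (0 < alpha)%E /\
    exists f : R -> X, set_surj `[0, 1] [set: X] f /\
      hoelder_unit_itv (fine alpha^-1%E) f].

End dimensions_of_a_metric.

Definition top_dim (R : realType) (X : topologicalType) : \bar R :=
  ereal_inf [set Dim d | d in @compatible_metrics R X].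

Definition top_Sdim (R : realType) (X : topologicalType) : \bar R :=
  ereal_inf [set SDim d | d in @compatible_metrics R X].

Definition top_Hodim (R : realType) (X : topologicalType) : \bar R :=
  ereal_inf [set HoDim d | d in @compatible_metrics R X].

(* Main.v *)
(** A finite connected cover of mesh eps yields walks that use each of its sets
in a single block.  Fix connected covers U_k of mesh eps_k = D / 2^k with N_k
members.  A walk of mesh eps_M visiting all of X is obtained by starting from a
point and, for k = 0, .., M - 1, inserting an excursion of diameter O(eps_k) to
each member of U_(k+1); refining chains of U_j to loop-free chains of U_(j+1)
makes each excursion decompose into O(N_j) blocks of diameter O(eps_j), for all
j >= k at once.  The whole walk then has about N_j^2 blocks at scale j, which is
where the factor 2 comes from: charging w_j = eps_j^alpha units of time to each
break between blocks costs a total time bounded independently of M as soon as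
alpha > 2 S-Dim, and points visited less than w_j apart in time are at distance
O(eps_j).  An ultrafilter limit as M tends to infinity gives a 1/alpha-Hoelder
surjection. *)

Require Import Defs.
From mathcomp Require Import all_boot all_order all_algebra.
From mathcomp Require Import all_classical all_reals all_analysis.
From mathcomp Require Import zify ring lra.

Set Implicit Arguments.
Unset Strict Implicit.
Unset Printing Implicit Defensive.

Import Order.TTheory GRing.Theory Num.Theory.
Import numFieldNormedType.Exports.

Local Open Scope classical_set_scope.
Local Open Scope ring_scope.

(** * Combinatorics of sequences cut into consecutive blocks *)

(** Each entry of [W] labels one block [e] of consecutive entries of [s]. Blocks may be empty, so
    passing to a subsequence keeps the same labels. *)
Inductive spread (A : Type) (B : eqType) (P : A -> B -> Prop) :
    seq A -> seq B -> Prop :=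
| spread_nil : spread P [::] [::]
| spread_cons a W e s : {in e, forall b, P a b} -> spread P W s ->
    spread P (a :: W) (e ++ s).

Section spread_theory.
Context (A : Type) (B : eqType).
Implicit Types (P : A -> B -> Prop) (W : seq A) (s : seq B).

Lemma spread_cat P W1 W2 s1 s2 :
  spread P W1 s1 -> spread P W2 s2 -> spread P (W1 ++ W2) (s1 ++ s2).
Proof.
move=> h h2; elim: h => //= a W e s He _ IH.
by rewrite -catA; exact: spread_cons.
Qed.

Lemma spread_nill P s : spread P [::] s -> s = [::].
Proof. by move=> h; inversion h. Qed.

Lemma spread_consl P a W s : spread P (a :: W) s ->
  exists e s', [/\ s = e ++ s', {in e, forall b, P a b} & spread P W s'].
Proof. by move=> h; inversion h; subst; exists e, s0. Qed.

Lemma spread_catl P W1 W2 s : spread P (W1 ++ W2) s ->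
  exists s1 s2, [/\ s = s1 ++ s2, spread P W1 s1 & spread P W2 s2].
Proof.
elim: W1 s => [|a W1 IH] s /=.
  by move=> h; exists [::], s; split => //; exact: spread_nil.
move=> /spread_consl[e [s' [-> He /IH[s1 [s2 [-> h1 h2]]]]]].
exists (e ++ s1), s2; split => //; first by rewrite catA.
exact: spread_cons.
Qed.

(** The cut falls inside at most one block, whose label is then used on both sides; this accounts
    for the extra unit. *)
Lemma spread_splitr P W s1 s2 : spread P W (s1 ++ s2) ->
  exists W1 W2, [/\ (size W1 + size W2 <= (size W).+1)%N,
    spread P W1 s1 & spread P W2 s2].
Proof.
move Es : (s1 ++ s2) => s h; elim: h s1 s2 Es => [|a W' e s' He h IH] s1 s2.
  case: s1 s2 => [|? ?] [|? ?] //= _.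
  by exists [::], [::]; split => //; exact: spread_nil.
have [le_se|lt_es] := leqP (size s1) (size e) => Es.
  have Ee : e = s1 ++ drop (size s1) e.
    rewrite -{1}(cat_take_drop (size s1) e); congr cat.
    have /(congr1 (take (size s1))) := Es.
    by rewrite take_size_cat // takel_cat.
  have Es2 : s2 = drop (size s1) e ++ s'.
    by move: Es; rewrite {1}Ee -catA => /eqP; rewrite eqseq_cat // eqxx => /eqP.
  exists [:: a], (a :: W'); split => //.
  - rewrite -(cats0 s1); apply: spread_cons; last exact: spread_nil.
    by move=> b bs; apply: He; rewrite Ee mem_cat bs.
  - rewrite Es2; apply: spread_cons => // b be.
    by apply: He; rewrite Ee mem_cat be orbT.
have Es1 : s1 = e ++ drop (size e) s1.
  rewrite -{1}(cat_take_drop (size e) s1); congr cat.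
  have /(congr1 (take (size e))) := Es.
  by rewrite takel_cat ?(ltnW lt_es)// take_size_cat.
have [|W1 [W2 [leW h1 h2]]] := IH (drop (size e) s1) s2.
  by move: Es; rewrite {1}Es1 -catA => /eqP; rewrite eqseq_cat // eqxx => /eqP.
exists (a :: W1), W2; split => //.
by rewrite Es1; exact: spread_cons.
Qed.

Lemma spread_subseq P W s s' : subseq s' s -> spread P W s -> spread P W s'.
Proof.
move=> ss h; elim: h s' ss => [|a W' e s0 He h IH] s'.
  by rewrite subseq0 => /eqP ->; exact: spread_nil.
move/subseqP => [m sm ->].
rewrite -(cat_take_drop (size e) m) mask_cat; last first.
  by rewrite size_takel // sm size_cat leq_addr.
apply: spread_cons; first by move=> b /mem_mask; exact: He.
by apply: IH; apply: mask_subseq.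
Qed.

Lemma spread_impl P (P' : A -> B -> Prop) W s :
  (forall a b, P a b -> P' a b) -> spread P W s -> spread P' W s.
Proof.
move=> PP'; elim=> [|a W' e s' He _ IH]; first exact: spread_nil.
by apply: spread_cons => // b /He /PP'.
Qed.

Lemma spread_label P W s (a0 : A) (b0 : B) : spread P W s ->
  exists lab : nat -> nat, {homo lab : i j / (i <= j)%N} /\
    forall i, (i < size s)%N ->
      (lab i < size W)%N /\ P (nth a0 W (lab i)) (nth b0 s i).
Proof.
elim=> [|a W' e s' He _ [lab [mlab Hlab]]]; first by exists id; split.
exists (fun i => if (i < size e)%N then 0 else (lab (i - size e)).+1)%N.
split=> [i j ij|i].
  case: (ltnP i) => // ei; rewrite (ltnNge j) (leq_trans ei ij) /= ltnS.
  exact/mlab/leq_sub2r.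
rewrite size_cat nth_cat; case: (ltnP i (size e)) => ie lti.
  by split => //=; apply: He; exact: mem_nth.
by apply: Hlab; rewrite ltn_subLR.
Qed.

End spread_theory.

Lemma spread_map (A A' : Type) (B : eqType) (P : A -> B -> Prop)
    (P' : A' -> B -> Prop) (g : A -> A') W s :
  (forall a b, P a b -> P' (g a) b) -> spread P W s -> spread P' (map g W) s.
Proof.
move=> PP'; elim=> [|a W' e s' He _ IH]; first exact: spread_nil.
by apply: spread_cons => // b /He /PP'.
Qed.

Lemma spread_comp (A : Type) (B C : eqType) (P : A -> B -> Prop)
    (Q : B -> C -> Prop) W W' s :
  spread P W W' -> spread Q W' s ->
  spread (fun a c => exists b, P a b /\ Q b c) W s.
Proof.
move=> h; elim: h s => [|a W0 e W0' He _ IH] s.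
  by move=> /spread_nill ->; exact: spread_nil.
move=> /spread_catl[s1 [s2 [-> h1 /IH h2]]]; apply: spread_cons => // c cs1.
elim: h1 He cs1 => // b W1 e' s' He' _ IH' He.
rewrite mem_cat => /orP[ce'|cs'].
  by exists b; split; [apply: He; rewrite mem_head|exact: He'].
by apply: IH' => // b' b'W; apply: He; rewrite inE b'W orbT.
Qed.

(** Loop erasure: when the start reappears in the erased tail, the path restarts from that
    occurrence. The subsequence clause is the point, since by [spread_subseq] it keeps a refined
    chain aligned with the coarser one. *)
Lemma path_uniq_subseq (T : eqType) (e : rel T) x p : path e x p ->
  exists p', [/\ path e x p', uniq (x :: p'), last x p' = last x p &
                 subseq p' p].
Proof.
elim: p x => [|y p IH] x /=; first by exists [::].
move=> /andP[exy /IH[p' [ep' up' lp' sp']]].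
have [xp'|xp'] := boolP (x \in y :: p'); last first.
  exists (y :: p'); split => //=; first by rewrite exy.
    by rewrite xp'; move: up'; rewrite /= => ->.
  by rewrite eqxx.
case/splitPr Ep : {1}(y :: p') / xp' => [p1 p2].
have sp2 : subseq p2 p'.
  case: p1 Ep => [|z p1] /= [_ ->]//.
  by rewrite -cat_rcons; exact: suffix_subseq.
have pth2 : path e x p2.
  case: p1 Ep => [|z p1] /= [yE pE]; first by rewrite -yE -pE.
  by move: ep'; rewrite pE cat_path => /andP[_ /= /andP[_]].
have lst2 : last x p2 = last y p.
  by rewrite -lp' -(last_cons x y p') Ep last_cat.
exists p2; split => //.
- by move: up'; rewrite Ep cat_uniq => /and3P[].
- exact: subseq_trans (subseq_trans sp2 sp') (subseq_cons _ _).
Qed.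

(** Unlike [spread], this keeps every entry of the original sequence, at the head of its own block,
    so that it remains available as a base point for insertions. *)
Inductive fatten (T : eqType) (P : T -> T -> Prop) : seq T -> seq T -> Prop :=
| fatten_nil : fatten P [::] [::]
| fatten_cons a e s s' : {in e, forall b, P a b} -> fatten P s s' ->
    fatten P (a :: s) (a :: e ++ s').

Section fatten_theory.
Context (T : eqType) (P : T -> T -> Prop).

Lemma fatten_refl s : fatten P s s.
Proof.
elim: s => [|a s IH]; first exact: fatten_nil.
exact: (@fatten_cons _ _ _ [::]).
Qed.

Lemma fatten_spread s s' : (forall a, P a a) -> fatten P s s' -> spread P s s'.
Proof.
move=> P0; elim=> [|a e s0 s0' He _ IH]; first exact: spread_nil.
rewrite -cat_cons; apply: spread_cons => // b.
by rewrite inE => /predU1P[->//|/He].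
Qed.

(** The insertion is made right after the original copy of [a], so the result is again a fattening
    of the same [s]. Hence repeated insertions do not accumulate distances. *)
Lemma fatten_insert s s' a e : fatten P s s' -> a \in s ->
  {in e, forall b, P a b} ->
  exists s1 s2, s' = s1 ++ a :: s2 /\ fatten P s (s1 ++ a :: e ++ s2).
Proof.
move=> h + He; elim: h => // b e' s0 s0' He' h IH; rewrite inE.
move=> /predU1P[ab|/IH[s1 [s2 [-> h']]]].
  subst b; exists [::], (e' ++ s0'); split => //=; rewrite catA.
  by apply: fatten_cons => // c; rewrite mem_cat => /orP[/He|/He'].
exists (b :: e' ++ s1), s2; split; first by rewrite /= catA.
by rewrite cat_cons -catA; exact: fatten_cons.
Qed.

End fatten_theory.

(** * Sequences of points in few small blocks *)

Section metric_blocks.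
Context (R : realType) (X : topologicalType) (d : X -> X -> R).
Hypothesis dm : is_metric d.

(** Blocks are measured by radius about an arbitrary centre, so that fattening by [rho] adds [rho]
    only once; the resulting diameter [2 * r] appears in [timed_walk]. *)
Definition nblocks (r : R) (L : nat) (s : seq X) : Prop :=
  exists W : seq X, (size W <= L)%N /\ spread (fun c x => d c x <= r) W s.

Lemma metric_refl x : d x x = 0.
Proof. by apply/(metric_eq0 dm). Qed.

Lemma nblocks_le r r' L L' s : r <= r' -> (L <= L')%N ->
  nblocks r L s -> nblocks r' L' s.
Proof.
move=> rr' LL' [W [sW h]]; exists W; split; first exact: leq_trans LL'.
by apply: spread_impl h => a b /le_trans; exact.
Qed.

Lemma nblocks_cat r L1 L2 s1 s2 :
  nblocks r L1 s1 -> nblocks r L2 s2 -> nblocks r (L1 + L2) (s1 ++ s2).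
Proof.
move=> [W1 [sW1 h1]] [W2 [sW2 h2]]; exists (W1 ++ W2).
by split; [rewrite size_cat leq_add|exact: spread_cat].
Qed.

(** The successor pays for the block that the insertion may cut in two. *)
Lemma nblocks_insert r L K s1 s2 e :
  nblocks r L (s1 ++ s2) -> nblocks r K e ->
  nblocks r (L + K).+1 (s1 ++ e ++ s2).
Proof.
move=> [W [sW /spread_splitr[W1 [W2 [sW12 h1 h2]]]]] [V [sV h]].
exists (W1 ++ V ++ W2); split; last by do 2?apply: spread_cat.
by rewrite !size_cat; lia.
Qed.

Lemma nblocks_fatten r rho L s s' : 0 <= rho ->
  fatten (fun a b => d a b <= rho) s s' ->
  nblocks r L s -> nblocks (r + rho) L s'.
Proof.
move=> rho0 /fatten_spread h [W [sW hW]]; exists W; split => //.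
have := spread_comp hW (h _); move=> H.
have {H}:= H (fun a => ltac:(by rewrite metric_refl)).
apply: spread_impl => a c [b [ab bc]].
by rewrite (le_trans (metric_tri dm _ b _))// lerD.
Qed.

Lemma nblocks1 r x : 0 <= r -> nblocks r 1 [:: x].
Proof.
move=> r0; exists [:: x]; split => //; rewrite -[X in spread _ _ X]cats0.
apply: spread_cons; last exact: spread_nil.
by move=> y; rewrite inE => /eqP ->; rewrite metric_refl.
Qed.

End metric_blocks.

(** * Chains of closed sets along a connected set *)

Lemma connected_chain (X : topologicalType) (n : nat) (U : 'I_n -> set X)
    (A : set X) (x y : X) :
  (forall c, closed (U c)) -> (forall z, exists c, U c z) ->
  connected A -> A x -> A y ->
  exists c p, [/\ U c x, path (fun i j => `[< U i `&` U j !=set0 >]) c p,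
    U (last c p) y & {in c :: p, forall i, U i `&` A !=set0}].
Proof.
move=> Ucl Ucov Aco Ax Ay; have [c0 Uc0x] := Ucov x.
pose e : rel 'I_n := fun i j =>
  `[< U i `&` U j !=set0 >] && `[< U j `&` A !=set0 >].
pose S b := \bigcup_(c in [set c | connect e c0 c = b]) U c.
(* The sets reachable from [c0] and the unreachable ones have closed unions, both unions being
   finite. On [A] these unions are disjoint, since a common point would give one more link; so [A]
   meets the reachable union in a clopen part, which is all of [A]. *)
have Scl b : closed (S b).
  by apply: closed_bigcup => //; exact: finite_finset.
have AS : A `&` S true = A.
  apply: Aco.
  - by exists x; split => //; exists c0 => //=; exact: connect0.
  - exists (~` S false); first by rewrite openC.
    apply/seteqP; split => z [Az].
      move=> [c /= cc Ucz]; split => // -[c' /= cc' Uc'z].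
      move: cc'; rewrite (connect_trans cc)// connect1// /e.
      by apply/andP; split; apply/asboolP; exists z.
    have [c Ucz] := Ucov z => nS; split => //; exists c => //=.
    by apply/negPn/negP => /negbTE cc; apply: nS; exists c.
  - by exists (S true).
have [_ [c /= /connectP[p pe cE] Ucy]] : (A `&` S true) y by rewrite AS.
exists c0, p; split => //.
- by apply: sub_path pe => i j /andP[].
- by rewrite -cE.
- move=> i; rewrite inE => /predU1P[->|ip]; first by exists x.
  elim: p c0 {Uc0x cE S Scl AS} pe ip => // j p IH c0 /= /andP[eij pe].
  rewrite inE => /predU1P[->|]; last exact: IH pe.
  by move: eij => /andP[_ /asboolP].
Qed.

Lemma ordinal1_eq n : n = 1%N -> forall i j : 'I_n, i = j.
Proof. by move=> -> i j; rewrite !ord1. Qed.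

(** * Walks with controlled blocks at all scales *)

Section multiscale_walk.
Context (R : realType) (X : topologicalType) (d : X -> X -> R).
Hypothesis dm : is_metric d.
Context (D : R) (N : nat -> nat) (U : forall k, 'I_(N k) -> set X).
Hypothesis D_gt0 : 0 < D.
Let eps (k : nat) : R := D / 2 ^+ k.
Hypothesis closedU : forall k (c : 'I_(N k)), closed (U c).
Hypothesis connectedU : forall k (c : 'I_(N k)), connected (U c).
Hypothesis coverU : forall k x, exists c : 'I_(N k), U c x.
Hypothesis diamU :
  forall k (c : 'I_(N k)) x y, U c x -> U c y -> d x y <= eps k.

Let eps_gt0 k : 0 < eps k.
Proof. by rewrite divr_gt0 // exprn_gt0. Qed.

Let epsS k : eps k = eps k.+1 + eps k.+1.
Proof. by rewrite /eps exprS; field; rewrite expf_neq0. Qed.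

Let adj k : rel 'I_(N k) := fun i j => `[< U i `&` U j !=set0 >].

(** Consecutive sets share a point, so each set of the chain has an entry and an exit point. These
    are joined inside it by [connected_chain], and the fine chains are concatenated. *)
Lemma refine_chain k (c : 'I_(N k)) p x y :
  path (@adj k) c p -> U c x -> U (last c p) y ->
  exists (c' : 'I_(N k.+1)) p', [/\ path (@adj k.+1) c' p', U c' x,
    U (last c' p') y &
    spread (fun i j => U i `&` U j !=set0) (c :: p) (c' :: p')].
Proof.
elim: p c x => [|c1 p IH] c x.
  move=> _ Ucx Ucy.
  have [c' [p' [Uc'x pp' Uly meet]]] :=
    connected_chain (@closedU k.+1) (@coverU k.+1) (@connectedU k c) Ucx Ucy.
  exists c', p'; split => //.
  rewrite -[X in spread _ _ X]cats0; apply: spread_cons; last exact: spread_nil.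
  by move=> i /meet; rewrite setIC.
move=> /= /andP[/asboolP[z [Ucz Uc1z]] pp] Ucx Uly.
have [c2 [p2 [pp2 Uc2z Ul2y sp2]]] := IH _ _ pp Uc1z Uly.
have [c' [p' [Uc'x pp' Ulz meet]]] :=
  connected_chain (@closedU k.+1) (@coverU k.+1) (@connectedU k c) Ucx Ucz.
exists c', (p' ++ c2 :: p2); split => //.
- by rewrite cat_path pp' /= pp2 andbT; apply/asboolP; exists z.
- by rewrite last_cat.
- rewrite -cat_cons; apply: spread_cons => // i /meet.
  by rewrite setIC.
Qed.

Lemma chain_walk M k (c : 'I_(N k)) p x y : k = M ->
  path (@adj k) c p -> U c x -> U (last c p) y ->
  exists s, [/\ path (fun a b => d a b <= eps M) x s, last x s = y &
    spread (fun i z => U i z) (c :: p) s].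
Proof.
move=> kM; subst k; elim: p c x => [|c1 p IH] c x /=.
  move=> _ Ucx Ucy; exists [:: y]; split => //=.
    by rewrite (diamU Ucx Ucy).
  rewrite -[X in spread _ _ X]cats0; apply: spread_cons; last exact: spread_nil.
  by move=> z; rewrite inE => /eqP ->.
move=> /andP[/asboolP[z [Ucz Uc1z]] pp] Ucx Uly.
have [s [ps ls sps]] := IH _ _ pp Uc1z Uly.
exists (z :: s); split => //=; first by rewrite (diamU Ucx Ucz).
rewrite -[z :: s]cat1s; apply: spread_cons => // w.
by rewrite inE => /eqP ->.
Qed.

Let near k (c : 'I_(N k)) (r : R) (z : X) := exists a, U c a /\ d a z <= r.

(** A loop-free list of labels has at most [N k] members, and a point of [U c] serves as centre of
    its block. For empty [U c] the default centre is harmless, as no point is near [c]. *)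
Lemma spread_near_nblocks k (W : seq 'I_(N k)) r r' s :
  uniq W -> r + eps k <= r' ->
  spread (fun c z => near c r z) W s -> nblocks d r' (N k) s.
Proof.
move=> uW rr' h.
case: s h => [|z0 s'] h.
  by exists [::]; split => //; exact: spread_nil.
pose pt (c : 'I_(N k)) : X := xget z0 (U c).
exists (map pt W); split.
  by rewrite size_map -(card_uniqP uW) -[leqRHS]card_ord max_card.
apply: spread_map h => c z [a [Uca daz]]; rewrite (le_trans _ rr')// addrC.
apply: (le_trans (metric_tri dm _ a _)); rewrite lerD //.
by apply: (diamU _ Uca); exact: (xgetPex _ (ex_intro _ a Uca)).
Qed.

(* Loop-erasing the refined chain keeps it aligned with the coarser one, so a
   single walk uses each set of each intermediate cover in one block only. *)
Lemma chain_refinement_walk i k (c : 'I_(N k)) p x y :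
  let M := (i + k)%N in
  path (@adj k) c p -> uniq (c :: p) -> U c x -> U (last c p) y ->
  exists s, [/\ path (fun a b => d a b <= eps M) x s, last x s = y,
    spread (fun c z => near c (eps k - eps M) z) (c :: p) s &
    forall j, (k <= j <= M)%N -> nblocks d (2 * eps j) (N j) s].
Proof.
elim: i k c p x y => [|i IH] k c p x y M pp up Ucx Uly.
  have [s [ps ls sps]] := chain_walk (esym (add0n k)) pp Ucx Uly.
  have sp : spread (fun c z => near c (eps k - eps M) z) (c :: p) s.
    apply: spread_impl sps => a z Uaz; exists z; split => //.
    by rewrite (metric_refl dm) /M add0n subrr.
  exists s; split => // j; rewrite /M add0n -eqn_leq => /eqP <-.
  apply: (spread_near_nblocks up _ sp); rewrite /M ?add0n subrr add0r.
  by have := eps_gt0 k; lra.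
have [c' [p0 [pp0 Uc'x Ul0y sp0]]] := refine_chain pp Ucx Uly.
have [p' [pp' up' lp' sbp']] := path_uniq_subseq pp0.
have sp' : spread (fun i j => U i `&` U j !=set0) (c :: p) (c' :: p').
  by apply: spread_subseq sp0; rewrite /= eqxx.
rewrite -lp' in Ul0y.
have := IH _ _ _ _ _ pp' up' Uc'x Ul0y; rewrite /= -addSnnS.
rewrite -/M => -[s [ps ls sps nb]].
have sp : spread (fun c z => near c (eps k - eps M) z) (c :: p) s.
  apply: spread_impl (spread_comp sp' sps) => a z.
  move=> [b [[u [Uau Ubu]] [v [Ubv dvz]]]].
  (* The set [U b] contributes at most [eps k.+1], and [eps k.+1 + (eps k.+1 - eps M)] equals
     [eps k - eps M]. *)
  exists u; split => //; apply: (le_trans (metric_tri dm _ v _)).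
  by have := diamU Ubu Ubv; have := epsS k; move: dvz; lra.
exists s; split => // j /andP[]; rewrite leq_eqVlt => /predU1P[<- _|kj jM].
  apply: (spread_near_nblocks up _ sp); have := eps_gt0 M; lra.
by apply: nb; rewrite kj.
Qed.

(** The chain with the single member [c] is refined: its only block keeps the whole walk near [U c],
    while the finer chains give the block counts. *)
Lemma excursion k M (c : 'I_(N k)) x y : (k <= M)%N -> U c x -> U c y ->
  exists s, [/\ path (fun a b => d a b <= eps M) x s, last x s = y,
    {in s, forall z, d x z <= 2 * eps k} &
    forall j, (k <= j <= M)%N -> nblocks d (2 * eps j) (N j) s].
Proof.
move=> kM Ucx Ucy.
have := @chain_refinement_walk (M - k) k c [::] x y isT isT Ucx Ucy.
rewrite /= subnK // => -[s [ps ls sps nb]]; exists s; split => // z zs.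
have [e [s' [sE He /spread_nill s'0]]] := spread_consl sps.
move: zs; rewrite sE s'0 cats0 => /He[u [Ucu duz]].
apply: (le_trans (metric_tri dm _ u _)).
by have := diamU Ucx Ucu; have := eps_gt0 M; move: duz; lra.
Qed.

Let visits k (V : seq X) (cs : seq 'I_(N k)) :=
  {in cs, forall c, U c !=set0 -> exists2 v, v \in V & U c v}.

(** For each nonempty [U c] a round trip from a point [v] of [V] to a point [y] of [U c] is inserted
    after [v], where [v] and [y] share a set of level [k]. The trip stays within [eps k + 2 * eps k]
    of [v]. At scale [j] it costs [N j] blocks each way and one for the cut. *)
Lemma insert_excursions k M V (cs : seq 'I_(N k.+1)) : (k <= M)%N ->
  sorted (fun a b => d a b <= eps M) V -> visits V (enum 'I_(N k)) ->
  exists V', [/\ sorted (fun a b => d a b <= eps M) V',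
    fatten (fun a b => d a b <= 3 * eps k) V V',
    visits V' cs &
    forall j L, (k <= j <= M)%N -> nblocks d (2 * eps j) L V ->
      nblocks d (2 * eps j) (L + size cs * (2 * N j).+1) V'].
Proof.
move=> kM sV vV; elim: cs => [|c cs [V' [sV' fV' visV' nbV']]].
  exists V; split => //; first exact: fatten_refl.
  by move=> j L _; rewrite mul0n addn0.
have [[y Ucy]|c0] := pselect (U c !=set0); last first.
  exists V'; split => //.
    by move=> i; rewrite inE => /predU1P[->//|/visV'].
  move=> j L jM /(nbV' _ _ jM); apply: nblocks_le => //=.
  by rewrite mulSn; lia.
have [c1 Uc1y] := coverU k y.
have [|v vinV Uc1v] := vV c1 _ (ex_intro _ y Uc1y); first by rewrite mem_enum.
have [e1 [pe1 le1 de1 nb1]] := excursion kM Uc1v Uc1y.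
have [e2 [pe2 le2 de2 nb2]] := excursion kM Uc1y Uc1v.
have de : {in e1 ++ e2, forall b, d v b <= 3 * eps k}.
  move=> b; rewrite mem_cat => /orP[/de1|/de2] h; have := eps_gt0 k.
    by move: h; lra.
  by have := metric_tri dm v y b; have := diamU Uc1v Uc1y; move: h; lra.
have [s1 [s2 [V'E fV'']]] := fatten_insert fV' vinV de.
exists (s1 ++ v :: (e1 ++ e2) ++ s2); split => //.
- have pe : path (fun a b => d a b <= eps M) v (e1 ++ e2).
    by rewrite cat_path pe1 le1.
  have le : last v (e1 ++ e2) = v by rewrite last_cat le1.
  move: sV'; rewrite V'E; case: (s1) => [|a s1'] /=.
    by rewrite cat_path pe le.
  by rewrite !cat_path /= cat_path pe le.
- move=> i; rewrite inE => /predU1P[->|/visV' ivis] [z Uiz].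
    exists y => //; rewrite mem_cat inE !mem_cat.
    have : y \in v :: e1 by rewrite -le1 mem_last.
    by rewrite inE => /orP[->|->]; rewrite ?orbT.
  have [|w wV' Uiw] := ivis; first by exists z.
  exists w => //; move: wV'; rewrite V'E !mem_cat !inE !mem_cat.
  by move=> /or3P[->|->|->]; rewrite ?orbT.
- move=> j L jM /(nbV' _ _ jM); rewrite V'E -cat_rcons => nbj.
  have := nblocks_insert nbj (nblocks_cat (nb1 _ jM) (nb2 _ jM)).
  rewrite cat_rcons; apply: nblocks_le => //=.
  by rewrite mulSn; lia.
Qed.

(** One initial block, and [(2 * N j).+1] more for each of the excursions made in the first [k]
    stages. *)
Let bound k j := (1 + (\sum_(i < k) N i.+1) * (2 * N j).+1)%N.

(** Stages [k <= j] add blocks at scale [j]. Later stages only thicken the existing ones, by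
    [3 * eps k] each, in total at most [3 * eps j]; with the initial radius [2 * eps j] this gives
    [5 * eps j]. *)
Lemma multiscale_walk M (x : X) : N 0 = 1%N ->
  exists V, [/\ V != [::], sorted (fun a b => d a b <= eps M) V,
    visits V (enum 'I_(N M)) &
    forall j, (j < M)%N -> nblocks d (5 * eps j) (bound j.+1 j) V].
Proof.
move=> N0.
(* Stage k fattens the blocks of each scale j < k by 3 * eps k, and
   5 * eps j - 6 * eps k telescopes: 3 * eps k = 6 * eps k - 6 * eps k.+1. *)
suff H k : (k <= M)%N -> exists V, [/\ V != [::],
    sorted (fun a b => d a b <= eps M) V, visits V (enum 'I_(N k)),
    forall j, (k <= j <= M)%N -> nblocks d (2 * eps j) (bound k j) V &
    forall j, (j < k)%N -> nblocks d (5 * eps j - 6 * eps k) (bound j.+1 j) V].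
  have [V [V0 sV vV _ nb]] := H M (leqnn M).
  exists V; split => // j /nb; apply: nblocks_le => //.
  by have := eps_gt0 M; lra.
elim: k => [_|k IH kM].
  exists [:: x]; split => //.
  (* As [N 0 = 1], the only set of level 0 contains [x], so a single point visits all of level 0. *)
  - move=> c _ _; exists x; first exact: mem_head.
    by have [c'] := coverU 0 x; rewrite (ordinal1_eq N0 c' c).
  - move=> j _; rewrite /bound big_ord0 mul0n; apply: (nblocks1 dm).
    by have := eps_gt0 j; lra.
have [V [V0 sV vV nbH nbL]] := IH (ltnW kM).
have [V' [sV' fV vV' nb']] :=
  insert_excursions (enum 'I_(N k.+1)) (ltnW kM) sV vV.
have boundS j :
    (bound k j + size (enum 'I_(N k.+1)) * (2 * N j).+1)%N = bound k.+1 j.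
  by rewrite /bound big_ord_recr /= size_enum_ord mulnDl addnA.
exists V'; split => //.
- by case: fV V0 => // a e s s' _ _ _.
- move=> j /andP[kj jM]; rewrite -boundS.
  apply: nb'; first by rewrite (ltnW kj).
  by apply: nbH; rewrite (ltnW kj).
- move=> j; rewrite ltnS leq_eqVlt => /predU1P[->|jk].
    apply: nblocks_le (nb' _ _ _ (nbH _ _));
      rewrite ?leqnn ?boundS ?(ltnW kM) //.
    by have := epsS k; lra.
  have eps3 : 0 <= 3 * eps k by have := eps_gt0 k; lra.
  apply: nblocks_le (nblocks_fatten dm eps3 fV (nbL _ jk)) => //.
  by have := epsS k; lra.
Qed.

End multiscale_walk.

(** * Parametrizing a walk by time *)

(* A break between two consecutive blocks of scale j costs time w j, so points
   visited less than w j apart in time lie in the same block. *)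
Lemma timed_walk (R : realType) (X : topologicalType) (d : X -> X -> R)
    (V : seq X) (M : nat) (w r : nat -> R) (L : nat -> nat) (del T : R) :
  is_metric d -> V != [::] -> 0 <= del ->
  sorted (fun a b => d a b <= del) V ->
  (forall j, (j < M)%N -> nblocks d (r j) (L j) V) ->
  (forall j, 0 < w j) -> 0 < T -> \sum_(j < M) w j * (L j)%:R <= T ->
  exists f : R -> X,
    (forall s t j, (j < M)%N -> T * `|s - t| < w j ->
      d (f s) (f t) <= 2 * r j + del) /\
    (forall v, v \in V -> exists t : R, 0 <= t <= 1 /\
      forall j, (j < M)%N -> d (f t) v <= 2 * r j).
Proof.
move=> dm; case: V => // x0 V0; set V := x0 :: V0 => _ del0 sV nb w_gt0 T0 wT.
have w0 j : 0 <= w j by exact: ltW.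
pose n := size V.
have [lab Hlab] : exists lab : nat -> nat -> nat, forall j, (j < M)%N ->
    [/\ {homo lab j : a b / (a <= b)%N},
        forall a, (a < n)%N -> (lab j a < L j)%N &
        forall a b, (a < n)%N -> (b < n)%N -> lab j a = lab j b ->
          d (nth x0 V a) (nth x0 V b) <= 2 * r j].
  have /choice[lab Hlab] : forall j, exists l : nat -> nat, (j < M)%N ->
    [/\ {homo l : a b / (a <= b)%N},
        forall a, (a < n)%N -> (l a < L j)%N &
        forall a b, (a < n)%N -> (b < n)%N -> l a = l b ->
          d (nth x0 V a) (nth x0 V b) <= 2 * r j].
    move=> j; case: (ltnP j M) => [jM|_]; last by exists id.
    have [W [sW /(spread_label x0 x0)[l [ml Hl]]]] := nb _ jM.
    exists l => _; split => // [a /Hl[la _]|a b /Hl[_ ha] /Hl[_ hb] lab].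
      exact: leq_trans la sW.
    have := metric_tri dm (nth x0 V a) (nth x0 W (l a)) (nth x0 V b).
    rewrite (metric_symm dm _ (nth x0 W _)); rewrite -lab in hb.
    by move: ha hb; lra.
  by exists lab.
(* The visiting time of entry [a], before division by [T]: the cost of its block index summed over
   all scales. All terms are nondecreasing in [a], so a change of block at scale [j] alone increases
   [tau] by at least [w j]. *)
pose tau a := \sum_(j < M) w j * (lab j a)%:R.
have tauE a b j : (j < M)%N -> (a <= b)%N -> tau b - tau a < w j ->
    lab j a = lab j b.
  move=> jM ab; rewrite /tau -sumrB => tlt; apply/eqP; rewrite eq_le.
  have [mj _ _] := Hlab _ jM; have lj := mj _ _ ab.
  rewrite [X in X && _]lj /= leNgt; apply/negP => ltj.
  move: tlt; apply/negP; rewrite -leNgt (bigD1 (Ordinal jM)) //= -[leLHS]addr0.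
  apply: lerD; last first.
    apply: sumr_ge0 => i _; rewrite -mulrBr mulr_ge0 // subr_ge0 ler_nat.
    by have [+ _ _] := Hlab _ (ltn_ord i); exact.
  by rewrite -mulrBr ler_peMr // -natrB // ler1n subn_gt0.
have tauT a : (a < n)%N -> 0 <= tau a <= T.
  move=> an; apply/andP; split.
    by apply: sumr_ge0 => i _; rewrite mulr_ge0.
  apply: le_trans wT; apply: ler_sum => i _; rewrite ler_wpM2l // ler_nat.
  by have [_ h _] := Hlab _ (ltn_ord i); rewrite ltnW // h.
pose Q s : pred nat := fun a => (a < n)%N && ((a == 0%N) || (tau a <= T * s)).
have exQ s : exists a, Q s a by exists 0%N; rewrite /Q eqxx.
have ubQ s a : Q s a -> (a <= n)%N by move=> /andP[/ltnW].
pose pos s := ex_maxn (exQ s) (ubQ s).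
have posP s : Q s (pos s) /\ forall a, Q s a -> (a <= pos s)%N.
  by rewrite /pos; case: ex_maxnP.
have mono s t j : s <= t -> (j < M)%N -> T * (t - s) < w j ->
    d (nth x0 V (pos s)) (nth x0 V (pos t)) <= 2 * r j + del.
  move=> st jM tw; have [_ _ dj] := Hlab _ jM.
  have [/andP[psn ps] psmax] := posP s; have [/andP[ptn pt] ptmax] := posP t.
  have : (pos s <= pos t)%N.
    apply: ptmax; rewrite /Q psn /=; case/orP: ps => [->//|ps].
    by rewrite (le_trans ps) ?orbT // ler_pM2l.
  rewrite leq_eqVlt => /predU1P[<-|ltp].
    by rewrite -[leLHS]addr0 lerD // dj.
  have spn := leq_ltn_trans ltp ptn.
  (* Entry [pos s] itself may have a [tau] far below [T * s], but its successor is visited after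
     [T * s]. One step of the walk costs [del], and from the successor to [pos t] less than [w j]
     elapses. *)
  rewrite addrC; apply: (le_trans (metric_tri dm _ (nth x0 V (pos s).+1) _)).
  apply: lerD; first by move/(sortedP x0) : sV; exact.
  apply: dj => //; apply: tauE => //.
  have tt : tau (pos t) <= T * t.
    by move: pt; case: (pos t) ltp.
  have ts : T * s < tau (pos s).+1.
    rewrite ltNge; apply/negP => h.
    by have := psmax (pos s).+1; rewrite /Q spn h orbT ltnn => /(_ isT).
  by move: tw; rewrite mulrBr; lra.
exists (fun s => nth x0 V (pos s)); split=> [s t j jM|v].
  case: (leP s t) => [st|/ltW ts].
    by rewrite distrC ger0_norm ?subr_ge0 //; exact: mono.
  rewrite ger0_norm ?subr_ge0 // (metric_symm dm); exact: mono.
move=> /(nthP x0)[a an <-]; have /andP[ta0 taT] := tauT _ an.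
(* At this time the position may be later than [a], but with the same [tau], hence in the same block
   at every scale. *)
exists (tau a / T); split.
  by rewrite divr_ge0 ?(ltW T0) //= ler_pdivrMr // mul1r.
move=> j jM; have [mj _ dj] := Hlab _ jM.
have TtE : T * (tau a / T) = tau a by rewrite mulrC divfK ?gt_eqF.
have [/andP[ptn pt] ptmax] := posP (tau a / T).
have ap : (a <= pos (tau a / T))%N.
  by apply: ptmax; rewrite /Q TtE lexx orbT andbT.
apply: dj => //; move: ap; rewrite leq_eqVlt => /predU1P[<-//|ap].
case/orP: pt => [/eqP pt|]; first by rewrite pt in ap.
rewrite TtE => tt; have lm := mj _ _ (ltnW ap).
by rewrite (tauE _ _ j jM (ltnW ap)) //; have := w_gt0 j; move: tt; lra.
Qed.

(** * Limits along an ultrafilter *)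

Lemma ultra_limit (X : topologicalType) (A : set X) (I : Type)
    (G : set_system I) (g : I -> X) : UltraFilter G -> compact A ->
  (forall i, A (g i)) ->
  exists p, A p /\ forall B, nbhs p B -> G (g @^-1` B).
Proof.
move=> uG cA gA; have [|p [Ap clp]] := cA (g @ G) _.
  by apply: (@filterS _ G _ setT) => [i _|]; [exact: gA|exact: filterT].
exists p; split => // B pB; have [//|nB] := in_ultra_setVsetC (g @^-1` B) uG.
by have [q [nBq Bq]] := clp (~` B) B nB pB.
Qed.

(** The limit is taken pointwise along an ultrafilter refining [\oo], and the modulus passes to it
    because [r] and [w] do not depend on [M]. For surjectivity, the times at which [F M] is near [x]
    converge along the same ultrafilter to some [p] in the unit interval, and [f p = x]. *)
Lemma limit_of_almost_hoelder (R : realType) (X : topologicalType)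
    (d : X -> X -> R) (F : nat -> R -> X) (w r e : nat -> R) (T : R) :
  is_metric d -> generates_topology d -> compact [set: X] ->
  0 < T -> (forall j, 0 < w j) -> r @ \oo --> (0 : R) -> e @ \oo --> (0 : R) ->
  (forall M s t j, (j < M)%N -> T * `|s - t| < w j ->
    d (F M s) (F M t) <= r j + e M) ->
  (forall M x, exists t : R, 0 <= t <= 1 /\
    forall j, (j < M)%N -> d (F M t) x <= r j + e M) ->
  exists f : R -> X,
    (forall s t j, T * `|s - t| < w j -> d (f s) (f t) <= r j) /\
    set_surj `[0, 1] [set: X] f.
Proof.
move=> dm gt cX T0 w0 r0 e0 hF dF.
have [G [uG ooG]] := @ultraFilterLemma nat \oo _.
have nball x (c : R) : 0 < c -> nbhs x [set y | d x y < c].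
  by move=> c0; apply/gt; exists c.
have /choice[f Hf] : forall s : R, exists p : X, forall B : set X, nbhs p B ->
    G ((fun M => F M s) @^-1` B).
  move=> s.
  have [//|p [_ Hp]] := @ultra_limit _ setT _ G (fun M => F M s) uG cX.
  by exists p.
have fG s c : 0 < c -> G [set M | d (f s) (F M s) < c].
  by move=> /(nball (f s)) /Hf.
have eG c : 0 < c -> G [set M | e M < c].
  move=> c0; apply: ooG; move/cvgr_lt : e0; exact.
have lG j : G [set M | (j < M)%N] by apply: ooG; exact: nbhs_infty_gt.
exists f; split=> [s t j st|x _].
  apply/ler_addgt0Pr => c c0; have c3 : 0 < c / 3 by rewrite divr_gt0.
  have [M [[[fs ft] eM] jM]] := filter_ex (filterI (filterI (filterI
    (fG s _ c3) (fG t _ c3)) (eG _ c3)) (lG j)).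
  have := metric_tri dm (f s) (F M s) (f t).
  have := metric_tri dm (F M s) (F M t) (f t).
  rewrite (metric_symm dm (F M t) (f t)); have := hF _ _ _ _ jM st.
  by move: fs ft eM => /=; lra.
have /choice[tt Htt] := fun M => dF M x.
have [p [/= p01 Hp]] : exists p : R, `[0, 1]%classic p /\
    forall B : set R, nbhs p B -> G (tt @^-1` B).
  apply: (ultra_limit (A := `[0, 1]%classic : set R)) => [|M].
    exact: segment_compact.
  by rewrite /= in_itv /=; case: (Htt M).
exists p => //; apply: esym; apply/(metric_eq0 dm)/eqP; rewrite eq_le.
rewrite (metric_ge0 dm) andbT; apply/ler_addgt0Pr => c c0.
(* Five errors are added: [r j] and [e M], twice each, and the distance from [F M p] to [f p]. *)
have c5 : 0 < c / 5 by rewrite divr_gt0.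
have [j rj] : exists j, r j < c / 5.
  by have /cvgr_lt /(_ _ c5) := r0 => /filter_ex[j]; exists j.
have tG : G [set M | T * `|p - tt M| < w j].
  apply: (Hp [set t | T * `|p - t| < w j]); apply/nbhs_ballP.
  exists (w j / T) => /=; first by rewrite divr_gt0.
  by move=> t /=; rewrite /ball /= ltr_pdivlMr // mulrC.
have [M [[[fp tM] eM] jM]] := filter_ex (filterI (filterI (filterI
    (fG p _ c5) tG) (eG _ c5)) (lG j)).
have [_ /(_ _ jM) dx] := Htt M.
have := hF _ _ _ _ jM tM.
have := metric_tri dm x (F M (tt M)) (f p).
have := metric_tri dm (F M (tt M)) (F M p) (f p).
rewrite (metric_symm dm x (F M _)) (metric_symm dm (F M p) (f p)).
rewrite (metric_symm dm (F M (tt M)) (F M p)).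
by move: fp eM dx => /=; lra.
Qed.

(** * A Hölder surjection from covers of geometric growth *)

Section hoelder_surjection.
Context (R : realType) (X : topologicalType) (d : X -> X -> R).
Hypotheses (dm : is_metric d) (dgen : generates_topology d).
Hypothesis compactX : compact [set: X].
Context (D K q alpha : R) (N : nat -> nat) (U : forall k, 'I_(N k) -> set X).
Hypotheses (D_gt0 : 0 < D) (K_ge1 : 1 <= K) (q_gt1 : 1 < q).
Hypotheses (alpha_gt0 : 0 < alpha) (q_alpha : q ^+ 2 < 2 `^ alpha).
Hypothesis closedU : forall k (c : 'I_(N k)), closed (U c).
Hypothesis connectedU : forall k (c : 'I_(N k)), connected (U c).
Hypothesis coverU : forall k x, exists c : 'I_(N k), U c x.
Hypothesis diamU :
  forall k (c : 'I_(N k)) x y, U c x -> U c y -> d x y <= D / 2 ^+ k.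
Hypotheses (N0 : N 0 = 1%N) (NK : forall k, (N k)%:R <= K * q ^+ k).

(** Thus [w j] is the [alpha]-th power of [2 ^- j], and [L j] is the block count [bound j.+1 j] of
    the multiscale walk. *)
Let p : R := 2 `^ alpha.
Let w j : R := p ^- j.
Let L j := (1 + (\sum_(i < j.+1) N i.+1) * (2 * N j).+1)%N.

Let q_gt0 : 0 < q. Proof. exact: lt_trans q_gt1. Qed.
Let p_gt1 : 1 < p.
Proof. by apply: le_lt_trans q_alpha; rewrite exprn_ege1 // ltW. Qed.
Let p_gt0 : 0 < p. Proof. exact: lt_trans p_gt1. Qed.

Let sum_N n : (\sum_(i < n) N i.+1)%:R <= K * (q ^+ n.+1 / (q - 1)).
Proof.
have q1 : 0 < q - 1 by rewrite subr_gt0.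
have K0 : 0 < K by apply: lt_le_trans K_ge1.
elim: n => [|n IH].
  by rewrite big_ord0 mulr_ge0 ?ltW // divr_gt0 // exprn_gt0.
rewrite big_ord_recr /= natrD (le_trans (lerD IH (NK _))) //.
rewrite -mulrDr ler_pM2l // le_eqVlt; apply/orP; left; apply/eqP.
by rewrite (exprS q n.+1); field; rewrite gt_eqF.
Qed.

(** The sum in [L j] is at most [K * q ^+ j.+2 / (q - 1)] and the factor [(2 * N j).+1] at most
    [3 * K * q ^+ j]. So [L j] grows like [q ^+ (2 * j)], and the total time converges as a
    geometric series of ratio [q ^+ 2 / p < 1]. *)
Let C : R := 1 + 3 * K ^+ 2 * q ^+ 2 / (q - 1).

Let L_le j : (L j)%:R <= C * (q ^+ 2) ^+ j.
Proof.
have q1 : 0 < q - 1 by rewrite subr_gt0.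
have K0 : 0 < K by apply: lt_le_trans K_ge1.
have qj : 1 <= q ^+ j by rewrite exprn_ege1 // ltW.
have Kq : 1 <= K * q ^+ j by rewrite -[leLHS]mulr1 ler_pM.
have hN : ((2 * N j).+1)%:R <= 3 * (K * q ^+ j).
  by rewrite -addn1 natrD natrM; have := NK j; move: Kq; lra.
rewrite /L natrD natrM.
have -> : C * (q ^+ 2) ^+ j =
    q ^+ j * q ^+ j + K * (q ^+ j.+2 / (q - 1)) * (3 * (K * q ^+ j)).
  by rewrite /C exprAC !exprS expr0; field; rewrite gt_eqF.
apply: lerD; first by rewrite -[leLHS]mulr1 ler_pM.
by apply: ler_pM => //; exact: sum_N.
Qed.

Let rho := q ^+ 2 / p.
Let T := C / (1 - rho).

Let rho01 : 0 < rho < 1.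
Proof. by rewrite divr_gt0 ?exprn_gt0 //= ltr_pdivrMr // mul1r. Qed.

Let C_gt0 : 0 < C.
Proof.
rewrite /C addr_gt0 // divr_gt0 ?subr_gt0 //.
by rewrite !mulr_gt0 ?exprn_gt0 // (lt_le_trans _ K_ge1).
Qed.

Let T_gt0 : 0 < T.
Proof. by rewrite divr_gt0 // subr_gt0; case/andP: rho01. Qed.

Let sum_wL M : \sum_(j < M) w j * (L j)%:R <= T.
Proof.
have /andP[r0 r1] := rho01; have r1' : 0 < 1 - rho by rewrite subr_gt0.
apply: (@le_trans _ _ (\sum_(j < M) C * rho ^+ j)).
  apply: ler_sum => j _; rewrite /rho exprMn exprVn mulrA mulrC.
  by rewrite ler_pM2r ?invr_gt0 ?exprn_gt0.
rewrite -mulr_sumr /T ler_pM2l // -[leRHS]mul1r ler_pdivlMr //.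
have -> : (\sum_(j < M) rho ^+ j) * (1 - rho) = 1 - rho ^+ M.
  elim: M => [|M IH]; first by rewrite big_ord0 mul0r expr0 subrr.
  by rewrite big_ord_recr /= mulrDl IH exprS; ring.
by rewrite lerBlDr lerDl exprn_ge0 // ltW.
Qed.

Let scale_cvg (c : R) : (fun k => c * (D / 2 ^+ k)) @ \oo --> (0 : R).
Proof.
have := @cvg_geometric R (c * D) 2^-1 _; rewrite ger0_norm ?invr_ge0 //.
move=> h; have {h} := h _; rewrite invf_lt1 // => h.
apply: cvg_trans (h _); last lra.
apply: near_eq_cvg; near=> k; rewrite /geometric /= exprVn; ring.
Unshelve. all: by end_near.
Qed.

Lemma multiscale_surjection (x0 : X) :
  exists f : R -> X,
    (forall s t j, T * `|s - t| < w j -> d (f s) (f t) <= 10 * (D / 2 ^+ j)) /\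
    set_surj `[0, 1] [set: X] f.
Proof.
have eps_gt0 k : 0 < D / 2 ^+ k by rewrite divr_gt0 ?exprn_gt0.
have w_gt0 j : 0 < w j by rewrite invr_gt0 exprn_gt0.
have /choice[F HF] : forall M : nat, exists f : R -> X,
    (forall s t j, (j < M)%N -> T * `|s - t| < w j ->
      d (f s) (f t) <= 10 * (D / 2 ^+ j) + D / 2 ^+ M) /\
    (forall x, exists t : R, 0 <= t <= 1 /\ forall j, (j < M)%N ->
      d (f t) x <= 10 * (D / 2 ^+ j) + D / 2 ^+ M).
  move=> M.
  have [V [V0 sV vV nb]] :=
    multiscale_walk dm D_gt0 closedU connectedU coverU diamU M x0 N0.
  have [f [hf vf]] := timed_walk dm V0 (ltW (eps_gt0 M)) sV nb w_gt0 T_gt0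
    (sum_wL M).
  exists f; split=> [s t j jM st|x].
    by have := hf _ _ _ jM st; lra.
  have [c Ucx] := coverU M x.
  have [|v vinV Ucv] := vV c _ (ex_intro _ x Ucx); first by rewrite mem_enum.
  have [t [t01 ht]] := vf _ vinV; exists t; split => // j jM.
  apply: (le_trans (metric_tri dm _ v _)); have := diamU Ucv Ucx.
  by have := ht _ jM; lra.
apply: (limit_of_almost_hoelder (F := F) (e := fun M => D / 2 ^+ M)) => //.
- by have := scale_cvg 1; under eq_fun do rewrite mul1r.
- by move=> M; have [h _] := HF M.
- by move=> M; have [_ h] := HF M.
Qed.

Lemma hoelder_surjection (x0 : X) :
  exists f : R -> X, set_surj `[0, 1] [set: X] f /\
    hoelder_unit_itv d alpha^-1 f.
Proof.
have [f [hf sf]] := multiscale_surjection x0; exists f; split => //.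
exists (20 * D * T `^ alpha^-1); first by rewrite !mulr_gt0 ?powR_gt0.
move=> s t _ _; rewrite -mulrA -powRM ?(ltW T_gt0) //.
set h := T * _.
have h0 : 0 <= h by rewrite mulr_ge0 // ltW.
have [h1|h1] := leP 1 h.
  have [c Ucs] := coverU 0 (f s); have [c' Uct] := coverU 0 (f t).
  have cc' := ordinal1_eq N0 c c'.
  rewrite -cc' in Uct; have := diamU Ucs Uct; rewrite expr0 divr1 => dD.
  have : 1 <= h `^ alpha^-1.
    have <- : (1 : R) `^ alpha^-1 = 1 by rewrite powR1.
    by rewrite ge0_ler_powR ?invr_ge0 ?nnegrE ?(ltW alpha_gt0).
  by move: dD D_gt0; nra.
have [->|st] := eqVneq s t.
  by rewrite (metric_refl dm) mulr_ge0 ?powR_ge0 // mulr_ge0 // ltW.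
have hpos : 0 < h by rewrite mulr_gt0 // normr_gt0 subr_eq0.
have exj : exists j, w j.+1 <= h.
  have := @cvg_geometric R 1 p^-1 _.
  rewrite ger0_norm ?invr_ge0 ?(ltW p_gt0) // invf_lt1 // => /(_ p_gt1).
  move=> /cvgr_le /(_ _ hpos) /filter_ex[j] /=.
  rewrite /geometric /= mul1r exprVn => hj; exists j.
  apply: le_trans hj; rewrite /w lef_pV2 ?posrE ?exprn_gt0 //.
  by rewrite exprS ler_peMl ?ltW ?exprn_gt0.
(* The least such [j] brackets [h] between [w j.+1] and [w j]: the upper bound controls the
   distance, the lower one turns [2 ^- j.+1] into a power of [h]. For [j = 0] the upper bound is
   [h < 1]. *)
case: (ex_minnP exj) => j wj minj.
have hj : h < w j.
  case: j wj minj => [|j] _ minj; first by rewrite /w expr0 invr1.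
  by rewrite ltNge; apply/negP => /minj; rewrite ltnn.
apply: (le_trans (hf _ _ _ hj)).
have -> : 10 * (D / 2 ^+ j) = 20 * D * 2 ^- j.+1.
  by rewrite exprS; field; rewrite expf_neq0.
rewrite ler_pM2l ?mulr_gt0 //.
have -> : 2 ^- j.+1 = w j.+1 `^ alpha^-1 :> R.
  rewrite /w /p -!powR_mulrn ?powR_ge0 // -powRrM -!powRN -powRrM.
  by rewrite mulNr mulrAC divff ?gt_eqF // mul1r.
by rewrite ge0_ler_powR ?nnegrE ?invr_ge0 ?exprn_ge0 ?(ltW p_gt0)
  ?(ltW alpha_gt0).
Qed.

End hoelder_surjection.

(** * Covering numbers and their growth exponents *)

Section covering_exponents.
Context (R : realType) (X : topologicalType) (d : X -> X -> R).
Implicit Types (P : set (set X)) (M : R -> \bar R).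

Lemma diam_leP (A : set X) (e : R) :
  (diam d A <= e%:E)%E <-> forall x y, A x -> A y -> d x y <= e.
Proof.
split=> [/ereal_supP h x y Ax Ay|h].
  by rewrite -lee_fin; apply: h; exists x => //; exists y.
by apply/ereal_supP => _ [x Ax [y Ay <-]]; rewrite lee_fin; exact: h.
Qed.

Lemma min_cover_lt P eps (c : R) : (min_cover d P eps < c%:E)%E ->
  exists n (U : 'I_n -> set X), [/\ n%:R < c, forall x, exists i, U i x,
    forall i, P (U i) & forall i x y, U i x -> U i y -> d x y <= eps].
Proof.
move=> /ereal_inf_lt[_ [n [C [Cn Ccov CP]] <-]]; rewrite lte_fin => nc.
have [f [fC _ fsurj]] : exists f : nat -> set X, set_bij `I_n C f.
  by apply/card_set_bijP; rewrite card_eq_sym.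
exists n, (fun i => f i); split => // [x|i|i].
- have [A CA Ax] : (\bigcup_(A in C) A) x by rewrite Ccov.
  by have [k kn fk] := fsurj _ CA; exists (Ordinal kn); rewrite /= fk.
- by have [] := CP (f i) (fC _ (ltn_ord i)).
- by apply/diam_leP; have [] := CP (f i) (fC _ (ltn_ord i)).
Qed.

Lemma min_cover_le P eps n (U : 'I_n -> set X) :
  (forall x, exists i, U i x) -> (forall i, P (U i)) ->
  (forall i x y, U i x -> U i y -> d x y <= eps) ->
  (min_cover d P eps <= n%:R%:E)%E.
Proof.
move=> Ucov UP Ud.
(* The family may repeat sets, so its range can have fewer than [n] members. *)
have /finite_setP[m Um] : finite_set (range U).
  by apply: finite_image; exact: finite_finset.
have mn : (m <= n)%N.
  rewrite -card_le_II -(card_le_eql Um).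
  apply: (card_le_trans (card_image_le _ _)).
  by rewrite -(card_le_eql card_II).
apply: ge_ereal_inf; exists (m%:R%:E); last by rewrite lee_fin ler_nat.
exists m => //; exists (range U); split => //.
  apply/seteqP; split => // x _; have [i Uix] := Ucov x.
  by exists (U i) => //; exists i.
by move=> _ [i _ <-]; split => //; apply/diam_leP; exact: Ud.
Qed.

Lemma le_min_cover P Q eps eps' : P `<=` Q -> eps <= eps' ->
  (min_cover d Q eps' <= min_cover d P eps)%E.
Proof.
move=> PQ ee'; apply: ereal_inf_le_tmp => _ [n [C [Cn Ccov CP]] <-].
exists n => //; exists C; split => // A CA.
have [PA dA] := CP _ CA; split; first exact: PQ.
by apply: (le_trans dA); rewrite lee_fin.
Qed.

Lemma min_cover_ge1 P eps (x : X) : (1 <= min_cover d P eps)%E.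
Proof.
apply: le_ereal_inf_tmp => _ [n [C [Cn Ccov CP]] <-]; rewrite lee_fin ler1n.
case: n Cn => // C0.
have [A CA _] : (\bigcup_(A in C) A) x by rewrite Ccov.
move: C0; rewrite II0 card_eq0 => /eqP C0.
by move: CA; rewrite C0.
Qed.

Lemma le_lne (x y : \bar R) : (x <= y)%E -> (lne x <= lne y)%E.
Proof.
have [x0|x0 xy] := leP x 0%E; first by rewrite le0_lneNy ?leNye.
by rewrite lee_lne // in_itv /= leey andbT ltW // (lt_le_trans x0 xy).
Qed.

Lemma at_right0P (V : set R) :
  (0^'+ V : Prop) <-> exists2 c : R, 0 < c & forall e, 0 < e < c -> V e.
Proof.
split=> [|[c c0 cV]].
  move=> /nbhs_ballP[c /= c0 cV]; exists c => // e /andP[e0 ec].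
  by apply: cV => //; rewrite /ball /= sub0r normrN gtr0_norm.
near=> e; apply: cV; apply/andP; split; near: e.
  exact: nbhs_right_gt.
exact: nbhs_right_lt.
Unshelve. all: by end_near.
Qed.

Lemma ln_inv_gt0 (e : R) : 0 < e < 1 -> 0 < ln e^-1.
Proof. by move=> /andP[e0 e1]; rewrite ln_gt0 // invf_gt1. Qed.

Lemma le_growth_exponent M M' : (forall e, 0 < e -> (M e <= M' e)%E) ->
  (growth_exponent M <= growth_exponent M')%E.
Proof.
move=> MM'; apply: le_ereal_inf_tmp => _ [V /at_right0P[c c0 cV] <-].
have m0 : 0 < Num.min c 1 by rewrite lt_min c0 ltr01.
apply: ge_ereal_inf; exists (ereal_sup ((fun e => lne (M e) / (ln e^-1)%:E)%E @`
    [set e | 0 < e < Num.min c 1])).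
  exists [set e | 0 < e < Num.min c 1] => //.
  by apply/at_right0P; exists (Num.min c 1).
apply: ge_ereal_sup => _ [e /= /andP[e0 ec] <-]; move: ec.
rewrite lt_min => /andP[ec e1].
apply: le_ereal_sup_tmp; exists (lne (M' e) / (ln e^-1)%:E)%E.
  by exists e => //; apply: cV; rewrite e0.
apply: lee_wpmul2r; last exact/le_lne/MM'.
by rewrite inve_ge0 lee_fin ltW // ln_inv_gt0 // e0.
Qed.

Lemma growth_exponent_ge0 M : (forall e, 0 < e -> (1 <= M e)%E) ->
  (0 <= growth_exponent M)%E.
Proof.
move=> M1; apply: le_ereal_inf_tmp => _ [V /at_right0P[c c0 cV] <-].
pose e := Num.min c 1 / 2.
have m0 : 0 < Num.min c 1 by rewrite lt_min c0 ltr01.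
have e0 : 0 < e by rewrite divr_gt0.
have /andP[ec e1] : (e < c) && (e < 1).
  by rewrite -lt_min /e; lra.
apply: le_ereal_sup_tmp; exists (lne (M e) / (ln e^-1)%:E)%E.
  by exists e => //; apply: cV; rewrite e0.
apply: mule_ge0; first by rewrite lne_ge0 M1.
by rewrite inve_ge0 lee_fin ltW // ln_inv_gt0 // e0.
Qed.

(** A limsup below [s] bounds the quotient by [s] near 0, and multiplying by [ln e^-1], positive for
    [e < 1], turns this into a power bound. The threshold is capped at [2^-1] to ensure [c < 1]. *)
Lemma growth_exponent_lt M (s : R) : (growth_exponent M < s%:E)%E ->
  exists2 c : R, 0 < c < 1 & forall e, 0 < e < c -> (M e < (e `^ (- s))%:E)%E.
Proof.
move=> /ereal_inf_lt[_ [V /at_right0P[c c0 cV] <-] Vs].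
exists (Num.min c 2^-1).
  by rewrite lt_min c0 invr_gt0 ltr0n /= gt_min invf_lt1 // ltr1n orbT.
move=> e; rewrite lt_min => /and3P[e0 ec e2].
have e1 : e < 1 by apply: (lt_trans e2); rewrite invf_lt1 // ltr1n.
have lne0 : 0 < ln e^-1 by apply: ln_inv_gt0; rewrite e0.
have : (lne (M e) / (ln e^-1)%:E < s%:E)%E.
  apply: le_lt_trans Vs; apply: ereal_sup_ubound; exists e => //.
  by apply: cV; rewrite e0.
rewrite inver gt_eqF // lte_pdivrMr // -EFinM.
have ps : 0 < e `^ (- s) by rewrite powR_gt0.
have -> : s * ln e^-1 = ln (e `^ (- s)).
  by rewrite ln_powR lnV ?posrE // mulrN mulNr.
case: (M e) => [r| |] //=; rewrite ?ltNyr // !lte_fin.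
have [r0 _|r0] := leP r 0; first exact: le_lt_trans ps.
by rewrite lte_fin ltr_ln.
Qed.

Lemma growth_exponent_le M (a : R) :
  (forall b, a < b -> exists2 c : R, 0 < c &
    forall e, 0 < e < c -> (M e <= (e `^ (- b))%:E)%E) ->
  (growth_exponent M <= a%:E)%E.
Proof.
move=> h; apply/lee_addgt0Pr => x x0; rewrite -EFinD.
have [c c0 cM] := h (a + x) ltac:(by rewrite ltrDl).
have m0 : 0 < Num.min c 1 by rewrite lt_min c0 ltr01.
apply: ge_ereal_inf; exists (ereal_sup ((fun e => lne (M e) / (ln e^-1)%:E)%E @`
    [set e | 0 < e < Num.min c 1])).
  exists [set e | 0 < e < Num.min c 1] => //.
  by apply/at_right0P; exists (Num.min c 1).
apply: ge_ereal_sup => _ [e /= /andP[e0 ec] <-]; move: ec.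
rewrite lt_min => /andP[ec e1].
have lne0 : 0 < ln e^-1 by apply: ln_inv_gt0; rewrite e0.
rewrite inver gt_eqF // lee_pdivrMr // -EFinM.
have -> : (a + x) * ln e^-1 = ln (e `^ (- (a + x))).
  by rewrite ln_powR lnV ?posrE // mulrN mulNr.
rewrite -lne_EFin ?powR_gt0 //; apply: le_lne; apply: cM.
by rewrite e0.
Qed.

End covering_exponents.

(** * Comparison of the dimensions of one metric *)

Section dimension_comparison.
Context (R : realType) (X : topologicalType) (d : X -> X -> R).
Hypotheses (dm : is_metric d) (dgen : generates_topology d).

Lemma hoelder_continuous (f : R -> X) (b : R) : 0 < b ->
  hoelder_unit_itv d b f -> {within `[0, 1], continuous f}.
Proof.
move=> b0 [C C0 hf]; apply/subspace_continuousP => x x01 B /dgen[e e0 eB].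
have eC : 0 < e / C by rewrite divr_gt0.
change (\forall y \near x, `[0, 1]%classic y -> B (f y)).
near=> y => y01; apply: eB => /=.
apply: (le_lt_trans (hf _ _ x01 y01)); rewrite mulrC -ltr_pdivlMr //.
have -> : e / C = ((e / C) `^ b^-1) `^ b.
  by rewrite -powRrM mulVf ?gt_eqF // powRr1 // ltW.
rewrite gt0_ltr_powR ?nnegrE ?powR_ge0 //; near: y.
by apply: nbhsx_ballx; rewrite powR_gt0.
Unshelve. all: by end_near.
Qed.

(** The cover consists of the images of [n.+1] consecutive intervals of length [n.+1%:R^-1]. *)
Lemma hoelder_connected_cover (f : R -> X) (C b : R) n : 0 < C -> 0 < b ->
  set_surj `[0, 1] [set: X] f ->
  {in `[0, 1] &, forall s t, d (f s) (f t) <= C * `|s - t| `^ b} ->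
  (connected_covering_number d (C * n.+1%:R^-1 `^ b) <= n.+1%:R%:E)%E.
Proof.
move=> C0 b0 sf hf.
have cf : {within `[0, 1], continuous f}.
  by apply: (hoelder_continuous b0); exists C.
pose J (i : 'I_n.+1) := `[i%:R / n.+1%:R, i.+1%:R / n.+1%:R]%classic : set R.
have J01 i : J i `<=` `[0, 1].
  move=> x; rewrite /J /= !in_itv /= => /andP[ix xi]; apply/andP; split.
    by apply: le_trans ix; rewrite divr_ge0.
  apply: (le_trans xi); rewrite ler_pdivrMr // mul1r ler_nat.
  exact: ltn_ord.
apply: (@min_cover_le _ _ _ _ _ _ (fun i => f @` J i)).
- move=> x; have [t t01 <-] := sf x I.
  have /andP[t0 t1] : 0 <= t <= 1 by move: t01; rewrite /= in_itv.
  have tn0 : 0 <= t * n.+1%:R by rewrite mulr_ge0.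
  have [t_lt1|t_ge1] := ltP t 1.
    have /andP[tl tr] := truncn_itv tn0.
    have kn : (Num.truncn (t * n.+1%:R) < n.+1)%N.
      by rewrite truncn_lt_nat // -[ltRHS]mul1r ltr_pM2r.
    exists (Ordinal kn), t => //; rewrite /J /= in_itv /=.
    by rewrite ler_pdivrMr // ler_pdivlMr // tl ltW.
  (* At [t = 1] the truncation would give the index [n.+1], which is out of range; the last interval
     is closed and contains 1. *)
  exists ord_max, t => //; rewrite /J /= in_itv /= divff //.
  by rewrite t1 andbT ler_pdivrMr // (le_trans _ (ler_peMl _ t_ge1)) // ler_nat.
- move=> i; apply: connected_continuous_connected.
    exact: segment_connected.
  exact: continuous_subspaceW (J01 i) cf.
- move=> i _ _ [s Js <-] [t Jt <-].
  apply: (le_trans (hf _ _ (J01 _ _ Js) (J01 _ _ Jt))).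
  rewrite ler_pM2l // ge0_ler_powR ?nnegrE ?invr_ge0 ?(ltW b0) //.
  move: Js Jt; rewrite /J /= !in_itv /= => /andP[si is_] /andP[ti it].
  have iE : i.+1%:R / n.+1%:R = i%:R / n.+1%:R + n.+1%:R^-1 :> R.
    by rewrite -natr1 mulrDl mul1r.
  move: si is_ ti it; rewrite iE ler_norml.
  move: (i%:R / n.+1%:R : R) (n.+1%:R^-1 : R) => u v *; apply/andP; split; lra.
Qed.

Lemma SDim_le_HoDim : (SDim d <= HoDim d)%E.
Proof.
apply: le_ereal_inf_tmp => -[a| |] [a0 [f [sf]]] //; last by rewrite leey.
rewrite lte_fin in a0; rewrite inver gt_eqF //= => -[C C0 hf].
apply: growth_exponent_le => b ab; have ba : 0 < b - a by rewrite subr_gt0.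
(* With about [(C / e) ^ a] intervals the images have diameter at most [e]. Rounding up costs 1, so
   the count is at most [K * e ^ (- a)] for [e < 1], and the threshold below lets [e ^ (- (b - a))]
   absorb [K]. *)
pose K := C `^ a + 1.
have K0 : 0 < K by rewrite ltr_wpDl ?powR_ge0.
exists (Num.min 1 (K `^ (- (b - a)^-1))).
  by rewrite lt_min ltr01 powR_gt0.
move=> e /andP[e0]; rewrite lt_min => /andP[e1 eK].
pose n := Num.truncn ((C / e) `^ a).
have x0 : 0 <= (C / e) `^ a by exact: powR_ge0.
have /andP[nx xn] := truncn_itv x0; rewrite -/n in nx xn.
have Ce : 0 < C / e by rewrite divr_gt0.
have h : C * n.+1%:R^-1 `^ a^-1 <= e.
  rewrite mulrC -ler_pdivlMr // -invf_div.
  have -> : (C / e)^-1 = ((C / e) `^ a)^-1 `^ a^-1.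
    by rewrite -powRN -powRrM mulNr divff ?gt_eqF // powRN powRr1 // ltW.
  rewrite ge0_ler_powR ?nnegrE ?invr_ge0 ?(ltW a0) //.
  by rewrite lef_pV2 ?posrE ?powR_gt0 // ltW.
have ai0 : 0 < a^-1 by rewrite invr_gt0.
have nE : n.+1%:R <= e `^ (- b).
  rewrite -natr1 (le_trans (lerD nx (lexx 1))) //.
  have -> : (C / e) `^ a = C `^ a * e `^ (- a).
    by rewrite powRM ?invr_ge0 ?ltW // -powR_inv1 ?ltW // -powRrM mulN1r.
  have ea : 1 <= e `^ (- a).
    rewrite powRN invf_ge1 ?powR_gt0 //.
    have <- : (1 : R) `^ a = 1 by rewrite powR1.
    by rewrite ge0_ler_powR ?nnegrE ?(ltW a0) ?(ltW e0) ?(ltW e1).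
  apply: (@le_trans _ _ (K * e `^ (- a))); first by rewrite mulrDl mul1r lerD2l.
  have -> : - b = - (b - a) + - a by ring.
  rewrite powRD; last by rewrite (gt_eqF e0) implybT.
  rewrite ler_pM2r ?powR_gt0 //.
  rewrite powRN -[K]invrK lef_pV2 ?posrE ?invr_gt0 ?powR_gt0 //.
  have -> : K^-1 = (K `^ (- (b - a)^-1)) `^ (b - a).
    by rewrite -powRrM mulNr mulVf ?gt_eqF // powR_inv1 // ltW.
  by rewrite ge0_ler_powR ?nnegrE ?powR_ge0 ?(ltW ba) ?(ltW e0) ?(ltW eK).
apply: (@le_trans _ _ n.+1%:R%:E); last by rewrite lee_fin.
apply: le_trans (hoelder_connected_cover n C0 ai0 sf hf).
exact: le_min_cover.
Qed.

Lemma Dim_le_SDim : (Dim d <= SDim d)%E.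
Proof. by apply: le_growth_exponent => e e0; exact: le_min_cover. Qed.

Lemma SDim_ge0 (x : X) : (0 <= SDim d)%E.
Proof. by apply: growth_exponent_ge0 => e e0; exact: min_cover_ge1. Qed.

(** Chains are built from closed sets, so connected covers are replaced by their closures, which
    stay connected and keep the diameter bound. *)
Lemma closure_diam (A : set X) (e : R) :
  (forall x y, A x -> A y -> d x y <= e) ->
  forall x y, closure A x -> closure A y -> d x y <= e.
Proof.
move=> Ae x y Ax Ay; apply/ler_addgt0Pr => c c0.
have c2 : 0 < c / 2 by rewrite divr_gt0.
have nball z : nbhs z [set u | d z u < c / 2] by apply/dgen; exists (c / 2).
have [u [Au /= xu]] := Ax _ (nball x); have [v [Av /= yv]] := Ay _ (nball y).
have := metric_tri dm x u y; have := metric_tri dm u v y.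
rewrite (metric_symm dm v y); have := Ae _ _ Au Av; lra.
Qed.

Lemma finite_cover_bounded (e : R) n (U : 'I_n -> set X) (x0 : X) :
  (forall x, exists i, U i x) ->
  (forall i x y, U i x -> U i y -> d x y <= e) ->
  exists B, forall x y, d x y <= B.
Proof.
move=> Ucov Ue; pose B := e + \sum_i d (xget x0 (U i)) x0.
have dB x : d x x0 <= B.
  have [i Uix] := Ucov x; rewrite /B (bigD1 i) //=.
  have := metric_tri dm x (xget x0 (U i)) x0.
  have := Ue _ _ _ Uix (xgetPex x0 (ex_intro _ x Uix)).
  have : 0 <= \sum_(j < n | j != i) d (xget x0 (U j)) x0.
    by apply: sumr_ge0 => j _; exact: metric_ge0.
  by lra.
exists (B + B) => x y; apply: (le_trans (metric_tri dm _ x0 _)).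
by rewrite lerD // (metric_symm dm).
Qed.

(** The connected covering number at [eta / 2 ^+ k] is below [K * q ^+ k] with [K = eta ^ (- s)] and
    [q = 2 ^ s]. The condition [q ^+ 2 < 2 ^ a] of the construction is then exactly [2 * s < a]. *)
Lemma HoDim_le (s a : R) : peano_continuum R X -> 0 < s -> 2 * s < a ->
  (SDim d < s%:E)%E -> (HoDim d <= a%:E)%E.
Proof.
move=> [_ [g [cg sg]]] s0 sa /growth_exponent_lt[c /andP[c0 c1] hc].
have a0 : 0 < a by apply: lt_trans sa; rewrite mulr_gt0.
have gT : g @` `[0, 1] = [set: X].
  by apply/seteqP; split => // x _; have [t t01 <-] := sg x I; exists t.
have cX : compact [set: X].
  by rewrite -gT; apply: continuous_compact => //; exact: segment_compact.
have conX : connected [set: X].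
  rewrite -gT; apply: connected_continuous_connected => //.
  exact: segment_connected.
pose x0 := g 0; pose eta := c / 2.
have eta0 : 0 < eta by rewrite divr_gt0.
have etak k : 0 < eta / 2 ^+ k < c.
  rewrite divr_gt0 ?exprn_gt0 //= ltr_pdivrMr ?exprn_gt0 //.
  have : 1 <= 2 ^+ k :> R by rewrite exprn_ege1 // ler1n.
  by rewrite /eta; nra.
have cov k := min_cover_lt (hc _ (etak k)).
have [B dB] : exists B, forall x y, d x y <= B.
  have [n [U [_ Ucov _ Ud]]] := cov 0%N.
  exact: finite_cover_bounded x0 Ucov Ud.
(* Level 0 is the whole space as a single set, which requires [B <= D]; the other levels use meshes
   [eta / 2 ^+ k], which requires [eta <= D]. *)
pose D := Num.max B eta.
have BD : B <= D by rewrite le_max lexx.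
have etaD : eta <= D by rewrite le_max lexx orbT.
have D0 : 0 < D by exact: lt_le_trans etaD.
pose K := eta `^ (- s); pose q := 2 `^ s : R.
have K1 : 1 <= K.
  rewrite /K powRN invf_ge1 ?powR_gt0 //.
  have <- : (1 : R) `^ s = 1 by rewrite powR1.
  by rewrite ge0_ler_powR ?nnegrE ?(ltW s0) ?(ltW eta0) // /eta; lra.
have /choice[Q HQ] : forall k, exists Q : {n & 'I_n -> set X},
    [/\ (k = 0%N -> projT1 Q = 1%N), (projT1 Q)%:R <= K * q ^+ k,
      forall x, exists i, projT2 Q i x,
      forall i, closed (projT2 Q i) /\ connected (projT2 Q i) &
      forall i x y, projT2 Q i x -> projT2 Q i y -> d x y <= D / 2 ^+ k].
  move=> [|k].
    exists (existT _ 1%N (fun=> setT)); split => //=.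
    - by rewrite expr0 mulr1.
    - by move=> x; exists ord0.
    - by move=> _ x y _ _; rewrite expr0 divr1 (le_trans (dB _ _)).
  have [n [U [nE Ucov Uco Ud]]] := cov k.+1.
  exists (existT _ n (fun i => closure (U i))); split => //=.
  - rewrite (le_trans (ltW nE)) // powRM ?invr_ge0 ?exprn_ge0 ?(ltW eta0) //.
    rewrite ler_pM2l ?powR_gt0 // /q -!powR_mulrn ?powR_ge0 //.
    by rewrite -powRN -!powRrM mulrNN mulrC.
  - by move=> x; have [i Uix] := Ucov x; exists i; exact: subset_closure.
  - move=> i; split; [exact: closed_closure|exact: connected_closure].
  - move=> i x y Ux Uy; apply: (@le_trans _ _ (eta / 2 ^+ k.+1)).
      exact: closure_diam (Ud i) _ _ Ux Uy.
    by rewrite ler_pM2r ?invr_gt0 ?exprn_gt0.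
pose N k := projT1 (Q k); pose U k : 'I_(N k) -> set X := projT2 (Q k).
have q1 : 1 < q.
  have <- : (1 : R) `^ s = 1 by rewrite powR1.
  by rewrite gt0_ltr_powR ?nnegrE // ltr1n.
have qa : q ^+ 2 < 2 `^ a.
  rewrite /q -powR_mulrn ?powR_ge0 // -powRrM.
  rewrite -ltr_ln ?posrE ?powR_gt0 // !ln_powR ltr_pM2r ?ln_gt0 ?ltr1n //.
  by rewrite mulrC.
have [f [sf hf]] : exists f : R -> X, set_surj `[0, 1] [set: X] f /\
    hoelder_unit_itv d a^-1 f.
  apply: (@hoelder_surjection _ _ _ dm dgen cX D K q a N U) => //.
  - by move=> k i; have [_ _ _ h _] := HQ k; have [] := h i.
  - by move=> k i; have [_ _ _ h _] := HQ k; have [] := h i.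
  - by move=> k; have [] := HQ k.
  - by move=> k; have [] := HQ k.
  - by have [h _ _ _ _] := HQ 0%N; exact: h.
  - by move=> k; have [] := HQ k.
apply: ereal_inf_lbound; split; first by rewrite lte_fin.
by exists f; split => //; rewrite inver gt_eqF.
Qed.

Lemma HoDim_le_2SDim : peano_continuum R X -> (HoDim d <= 2%:E * SDim d)%E.
Proof.
move=> pX; have [_ [g _]] := pX; have := SDim_ge0 (g 0).
case E : (SDim d) => [s| |] // s0; last by rewrite gt0_muley ?lte_fin ?leey.
rewrite lee_fin in s0; apply/lee_addgt0Pr => e e0.
(* The exponent [s + e / 4] is positive, exceeds [SDim d], and its double is below [2 * s + e]. *)
rewrite -EFinM -EFinD; apply: (@HoDim_le (s + e / 4)) => //; last first.
- by rewrite E lte_fin; lra.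
- by lra.
- by lra.
Qed.

End dimension_comparison.

Theorem corollary1p3 (R : realType) (X : topologicalType)
    (hX : peano_continuum R X) :
  (top_dim R X <= top_Sdim R X)%E /\
  (top_Sdim R X <= top_Hodim R X)%E /\
  (top_Hodim R X <= 2%:E * top_Sdim R X)%E.
Proof.
split; last split.
- apply: le_ereal_inf_tmp => _ [d [dm dgen] <-].
  apply: ge_ereal_inf; exists (Dim d); [by exists d|exact: Dim_le_SDim].
- apply: le_ereal_inf_tmp => _ [d [dm dgen] <-].
  apply: ge_ereal_inf; exists (SDim d); [by exists d|exact: SDim_le_HoDim].
(* The factor 2 is moved to the left so that the right side is a bare infimum, and moved back for
   each single metric. *)
- rewrite -lee_pdivrMl //; apply: le_ereal_inf_tmp => _ [d [dm dgen] <-].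
  rewrite lee_pdivrMl //; apply: ge_ereal_inf; exists (HoDim d).
    by exists d.
  exact: HoDim_le_2SDim.
Qed.
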